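(* Let $n\ge0$ and let $H_n$ be the pyrene system with $n$ pyrene fragments. Then the sum of the anti-forcing numbers of all perfect matchings of $H_n$ is $$\sum_{M}af(H_n,M)=\frac{3\sqrt{2}}{64}(3-2\sqrt{2})^n+\frac{17-12\sqrt{2}}{16}n(3-2\sqrt{2})^n-\frac{3\sqrt{2}}{64}(3+2\sqrt{2})^n+\frac{17+12\sqrt{2}}{16}n(3+2\sqrt{2})^n.$$
   Context: Pyrene system: draw the hexagonal lattice so that every hexagon has two vertical sides; horizontally adjacent hexagons then share a vertical edge. For $n\ge1$, $H_n$ is the hexagonal system (the plane graph formed by the vertices and edges of the following $4n$ hexagons) consisting of a horizontal linear row of $2n$ hexagons $h_{1,1},h_{1,2},\dots,h_{n,1},h_{n,2}$, consecutive ones sharing a vertical edge, together with, for each $i$, a hexagon $s_{i,1}$ directly above and a hexagon $s_{i,2}$ directly below the common edge of $h_{i,1}$ and $h_{i,2}$ (each sharing an edge with both $h_{i,1}$ and $h_{i,2}$). $H_0$ is the null graph, which has one (empty) perfect matching with anti-forcing number $0$. For a perfect matching $M$ of $G$, an anti-forcing set of $M$ is a set $S\subseteq E(G)\setminus M$ such that $M$ is the unique perfect matching of $G-S$; the anti-forcing number $af(G,M)$ is the minimum size of an anti-forcing set of $M$. The sum is over all perfect matchings $M$ of $H_n$ (equivalently, it is $\frac{d}{dx}Af(H_n,x)|_{x=1}$ with $Af(G,x)=\sum_M x^{af(G,M)}$). *)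

(* Defs.v *)
From mathcomp Require Import all_boot all_order all_algebra.
Set Implicit Arguments. Unset Strict Implicit. Unset Printing Implicit Defensive.

(* A (simple) graph is given by a vertex set VG : {set V} and an edge set
   E : {set {set V}} whose elements are 2-element subsets of VG.            *)

Definition perfect_matching (V : finType) (VG : {set V}) (E M : {set {set V}}) : bool :=
  (M \subset E) && [forall v in VG, #|[set e in M | v \in e]| == 1].

Definition anti_forcing_set (V : finType) (VG : {set V}) (E M S : {set {set V}}) : bool :=
  (S \subset E :\: M) &&
  [forall M' : {set {set V}}, perfect_matching VG (E :\: S) M' ==> (M' == M)].

(* af(G, M): the minimum size of an anti-forcing set of M.  (For a perfect
   matching M, E \ M is always an anti-forcing set, so the set of candidates
   is nonempty and the default value #|E| of the fold is never the answer
   unless it is attained.) *)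
Definition anti_forcing_number (V : finType) (VG : {set V}) (E M : {set {set V}}) : nat :=
  \big[minn/#|E|]_(S : {set {set V}} | anti_forcing_set VG E M S) #|S|.

(* Hexagonal lattice with vertical hexagon sides, in integer coordinates:
   the hexagon with center (a, b) has vertices, in cyclic order,
   (a,b+2), (a+1,b+1), (a+1,b-1), (a,b-2), (a-1,b-1), (a-1,b+1);
   its two vertical sides are x = a-1 and x = a+1.  Horizontally adjacent
   hexagons have centers (a,b), (a+2,b) and share the vertical edge x = a+1;
   the hexagon with center (a+1,b+3) (resp. (a+1,b-3)) lies directly above
   (resp. below) that common edge and shares an edge with both. *)
Definition hex_vertices (c : nat * nat) : seq (nat * nat) :=
  let: (a, b) := c in
  [:: (a, b.+2); (a.+1, b.+1); (a.+1, b.-1); (a, b - 2); (a.-1, b.-1); (a.-1, b.+1)].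

(* Centers of the 4n hexagons of H_n (coordinates shifted so all vertex
   coordinates are natural numbers): for i = 0..n-1,
   h_{i+1,1} at (4i+1, 5), h_{i+1,2} at (4i+3, 5),
   s_{i+1,1} at (4i+2, 8) (above), s_{i+1,2} at (4i+2, 2) (below). *)
Definition pyrene_centers (n : nat) : seq (nat * nat) :=
  flatten [seq [:: (4 * i + 1, 5); (4 * i + 3, 5); (4 * i + 2, 8); (4 * i + 2, 2)]
          | i <- iota 0 n].

(* All vertices of H_n have x-coordinate <= 4n and y-coordinate <= 10. *)
Definition pyr_vertex (n : nat) : finType := ('I_(4 * n).+1 * 'I_11)%type.

Definition to_vertex (n : nat) (p : nat * nat) : pyr_vertex n := (inord p.1, inord p.2).

Definition hex_edges_of (n : nat) (c : nat * nat) : {set {set pyr_vertex n}} :=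
  let vs := map (@to_vertex n) (hex_vertices c) in
  [set [set e.1; e.2] | e in zip vs (rot 1 vs)].

Definition pyrene_V (n : nat) : {set pyr_vertex n} :=
  \bigcup_(c <- pyrene_centers n) [set v in map (@to_vertex n) (hex_vertices c)].

Definition pyrene_E (n : nat) : {set {set pyr_vertex n}} :=
  \bigcup_(c <- pyrene_centers n) hex_edges_of n c.

(* Main.v *)
Require Import Defs.
From mathcomp Require Import all_boot all_order all_algebra.
From mathcomp Require Import zify ring.
Set Implicit Arguments. Unset Strict Implicit. Unset Printing Implicit Defensive.

(* Cut H_n into n pyrene fragments.  Counting colour classes above and below
   the rungs shows that a perfect matching restricts to each fragment in one of
   six ways: A (both left arms and the middle rung), B (both right arms and the
   middle rung), or N(u,d) (an independent choice of one of the two matchings of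
   the upper and of the lower hexagon).  The rungs between fragments are then
   determined, and the only constraint is that B is never followed by A.

   The anti-forcing number is the sum of the letter weights, 1 for A and B, and
   2 + [u = d] for N(u,d).  For the lower bound, one exhibits for each unit of
   weight another perfect matching M' such that the sets M' \ M are pairwise
   disjoint; an anti-forcing set meets each of them.  For the upper bound, one
   deletes at an N one edge of each hexagon, and the middle rung if u = d, which
   pins that letter down; at an A its left rung and at a B its right rung.

   The generating polynomials of the words thus satisfy
   G(n+2) = (2x + 2x^2 + 2x^3) G(n+1) - x^2 G(n), and the closed form follows
   by differentiating at x = 1. *)

(* Fragment i occupies 4i <= x <= 4i + 4; the boolean is true in the upper half.
   Col and Rung at i are those of the column x = 4i, so i ranges up to n. *)
Inductive vkind : Type :=
  | Col of bool | JoinL of bool | Center of bool | JoinR of bool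
  | ShoulderL of bool | Apex of bool | ShoulderR of bool.

Inductive ekind : Type :=
  | Rung | Mid
  | ArmL of bool | InnerL of bool | InnerR of bool | ArmR of bool
  | SideL of bool | TopL of bool | TopR of bool | SideR of bool.

Definition coord (p : nat * vkind) : nat * nat :=
  let: (i, k) := p in
  match k with
  | Col s => (4 * i, if s then 6 else 4)
  | JoinL s => (4 * i + 1, if s then 7 else 3)
  | Center s => (4 * i + 2, if s then 6 else 4)
  | JoinR s => (4 * i + 3, if s then 7 else 3)
  | ShoulderL s => (4 * i + 1, if s then 9 else 1)
  | Apex s => (4 * i + 2, if s then 10 else 0)
  | ShoulderR s => (4 * i + 3, if s then 9 else 1)
  end.

Definition ends (i : nat) (k : ekind) : (nat * vkind) * (nat * vkind) :=
  match k with
  | Rung => ((i, Col true), (i, Col false))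
  | Mid => ((i, Center true), (i, Center false))
  | ArmL s => ((i, Col s), (i, JoinL s))
  | InnerL s => ((i, JoinL s), (i, Center s))
  | InnerR s => ((i, Center s), (i, JoinR s))
  | ArmR s => ((i, JoinR s), (i.+1, Col s))
  | SideL s => ((i, JoinL s), (i, ShoulderL s))
  | TopL s => ((i, ShoulderL s), (i, Apex s))
  | TopR s => ((i, Apex s), (i, ShoulderR s))
  | SideR s => ((i, ShoulderR s), (i, JoinR s))
  end.

Definition vvalid (n : nat) (p : nat * vkind) : bool :=
  (0 < n) && (if p.2 is Col _ then p.1 <= n else p.1 < n).

Definition evalid (n i : nat) (k : ekind) : bool :=
  (0 < n) && (if k is Rung then i <= n else i < n).

Definition vt (n : nat) (p : nat * vkind) : pyr_vertex n := to_vertex n (coord p).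

Definition ed (n i : nat) (k : ekind) : {set pyr_vertex n} :=
  [set vt n (ends i k).1; vt n (ends i k).2].

Lemma coord_inj : injective coord.
Proof.
move=> [i k] [j l] E; move: (congr1 fst E) (congr1 snd E) => {E}.
by case: k => -[]; case: l => -[] /= e1 e2; (exfalso; lia) || (have -> : i = j by lia).
Qed.

Lemma coord_bound n p : vvalid n p -> (coord p).1 <= 4 * n /\ (coord p).2 <= 10.
Proof.
case: p => i k; rewrite /vvalid /=; case: k => s /=; case: s => /= /andP[_ H]; split=> //; lia.
Qed.

Lemma vt_inj n p q : vvalid n p -> vvalid n q -> vt n p = vt n q -> p = q.
Proof.
move=> /coord_bound[p1 p2] /coord_bound[q1 q2] [].
move=> /(congr1 val) /= + /(congr1 val) /=; rewrite !inordK //= => e1 e2.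
by apply: coord_inj; case: (coord p) (coord q) e1 e2 => [? ?] [? ?] /= -> ->.
Qed.

Lemma vvalid_ends n i k : evalid n i k -> vvalid n (ends i k).1 && vvalid n (ends i k).2.
Proof. by case: k => [||s|s|s|s|s|s|s|s]; rewrite /evalid /vvalid /= => /andP[-> H] /=; lia. Qed.

Lemma ends_inj i k j l : ends i k = ends j l -> (i, k) = (j, l).
Proof.
by case: k => [||s|s|s|s|s|s|s|s]; case: l => [||t|t|t|t|t|t|t|t] //= [] *; subst.
Qed.

Lemma ends_swap i k j l : ends i k = ((ends j l).2, (ends j l).1) -> False.
Proof.
by case: k => [||s|s|s|s|s|s|s|s]; case: l => [||t|t|t|t|t|t|t|t].
Qed.

Lemma ends_neq i k : (ends i k).1 <> (ends i k).2.
Proof. by case: k. Qed.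

Lemma in_ed n i k p : evalid n i k -> vvalid n p ->
  vt n p \in ed n i k -> p = (ends i k).1 \/ p = (ends i k).2.
Proof.
move=> /vvalid_ends/andP[h1 h2] hp; rewrite !inE => /orP[]/eqP/vt_inj H.
- by left; apply: H.
- by right; apply: H.
Qed.

Lemma ed_inj n i k j l : evalid n i k -> evalid n j l ->
  ed n i k = ed n j l -> (i, k) = (j, l).
Proof.
move=> h h' E; have /andP[h1 h2] := vvalid_ends h.
have := in_ed h' h1; rewrite -E set21 => /(_ isT) H1.
have := in_ed h' h2; rewrite -E set22 => /(_ isT) H2.
have := @ends_neq i k.
have := @ends_inj i k j l; have := @ends_swap i k j l.
case: (ends i k) H1 H2 => a b /=; case: (ends j l) => c d /=.
by case=> -> [] -> swap inj neq; [case: neq | apply: inj | case: swap | case: neq].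
Qed.

Lemma zip_map_pair (T1 T2 : Type) (f : T1 -> T2) (s t : seq T1) :
  zip (map f s) (map f t) = [seq (f e.1, f e.2) | e <- zip s t].
Proof. by elim: s t => [|x s IH] [|y t] //=; rewrite IH. Qed.

Lemma hex_edges_ofE n c : hex_edges_of n c =i
  [seq [set to_vertex n e.1; to_vertex n e.2] | e <- zip (hex_vertices c) (rot 1 (hex_vertices c))].
Proof.
move=> e; rewrite /hex_edges_of; cbv zeta; rewrite -map_rot zip_map_pair.
apply/imsetP/mapP => -[x].
- move=> /mapP[[p q] pq ->] ->.
  by exists (p, q).
- move=> xin ->; exists (to_vertex n x.1, to_vertex n x.2) => //.
  by apply/mapP; exists x.
Qed.

Lemma ed_sym n i k : ed n i k = [set vt n (ends i k).2; vt n (ends i k).1].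
Proof. by rewrite /ed setUC. Qed.

Lemma hex_edges_left n i : hex_edges_of n (4 * i + 1, 5) =i
  [:: ed n i (InnerL true); ed n i Mid; ed n i (InnerL false);
      ed n i (ArmL false); ed n i Rung; ed n i (ArmL true)].
Proof.
move=> e; rewrite hex_edges_ofE.
rewrite (ed_sym n i (InnerL false)) (ed_sym n i (ArmL false)) (ed_sym n i Rung).
by rewrite /ed /vt /= addn1 addn2.
Qed.

Lemma hex_edges_right n i : hex_edges_of n (4 * i + 3, 5) =i
  [:: ed n i (ArmR true); ed n i.+1 Rung; ed n i (ArmR false);
      ed n i (InnerR false); ed n i Mid; ed n i (InnerR true)].
Proof.
move=> e; rewrite hex_edges_ofE.
rewrite (ed_sym n i (ArmR false)) (ed_sym n i (InnerR false)) (ed_sym n i Mid).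
by rewrite /ed /vt /= addn3 addn2 mulnS.
Qed.

Lemma hex_edges_top n i : hex_edges_of n (4 * i + 2, 8) =i
  [:: ed n i (TopR true); ed n i (SideR true); ed n i (InnerR true);
      ed n i (InnerL true); ed n i (SideL true); ed n i (TopL true)].
Proof.
move=> e; rewrite hex_edges_ofE.
rewrite (ed_sym n i (InnerR true)) (ed_sym n i (InnerL true)).
by rewrite /ed /vt /= addn3 addn2 addn1.
Qed.

Lemma hex_edges_bottom n i : hex_edges_of n (4 * i + 2, 2) =i
  [:: ed n i (InnerR false); ed n i (SideR false); ed n i (TopR false);
      ed n i (TopL false); ed n i (SideL false); ed n i (InnerL false)].
Proof.
move=> e; rewrite hex_edges_ofE.
rewrite (ed_sym n i (SideR false)) (ed_sym n i (TopR false)).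
rewrite (ed_sym n i (TopL false)) (ed_sym n i (SideL false)).
by rewrite /ed /vt /= addn3 addn2 addn1.
Qed.

Lemma in_bigcup_seq (T : finType) (I : eqType) (r : seq I) (F : I -> {set T}) x :
  reflect (exists2 i, i \in r & x \in F i) (x \in \bigcup_(i <- r) F i).
Proof.
rewrite (big_morph (fun A : {set T} => x \in A) (in_setU x) (in_set0 x)) big_has.
exact: hasP.
Qed.

Lemma pyrene_centersP n c :
  reflect (exists2 i, i < n &
            c \in [:: (4 * i + 1, 5); (4 * i + 3, 5); (4 * i + 2, 8); (4 * i + 2, 2)])
    (c \in pyrene_centers n).
Proof.
by apply: (iffP flatten_mapP) => -[i]; rewrite ?mem_iota => h1 h2; exists i;
   rewrite ?mem_iota.
Qed.

Lemma pyrene_EP n e :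
  reflect (exists i k, evalid n i k /\ e = ed n i k) (e \in pyrene_E n).
Proof.
apply: (iffP (in_bigcup_seq _ _ _)).
- case=> c /pyrene_centersP[i lt_in].
  have n0 : 0 < n by apply: leq_ltn_trans lt_in.
  rewrite !inE => /or4P[]/eqP->;
    rewrite ?hex_edges_left ?hex_edges_right ?hex_edges_top ?hex_edges_bottom !inE;
    do 5?[case/orP]; move=> /eqP->; do 2!eexists; (split; last by reflexivity);
    by rewrite /evalid n0 //= ltnW.
- case=> i [k []] /andP[n0 lt_in] ->.
  have at_hex (j : nat) (c : nat * nat) : j < n ->
      c \in [:: (4 * j + 1, 5); (4 * j + 3, 5); (4 * j + 2, 8); (4 * j + 2, 2)] ->
      ed n i k \in hex_edges_of n c ->
      exists2 c, c \in pyrene_centers n & ed n i k \in hex_edges_of n c.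
    by move=> lt_jn cj ec; exists c => //; apply/pyrene_centersP; exists j.
  case: k lt_in at_hex => [||s|s|s|s|s|s|s|s] /= lt_in at_hex.
  + move: lt_in; rewrite leq_eqVlt => /orP[/eqP ein|lt_in].
      have e1 : i = i.-1.+1 by lia.
      by apply: (at_hex i.-1 (4 * i.-1 + 3, 5));
         rewrite ?hex_edges_right -?e1 ?inE ?eqxx ?orbT //; lia.
    by apply: (at_hex i (4 * i + 1, 5)); rewrite ?hex_edges_left ?inE ?eqxx ?orbT.
  + by apply: (at_hex i (4 * i + 1, 5)); rewrite ?hex_edges_left ?inE ?eqxx ?orbT.
  + by apply: (at_hex i (4 * i + 1, 5)); case: s {at_hex};
       rewrite ?hex_edges_left ?inE ?eqxx ?orbT.
  + by apply: (at_hex i (4 * i + 1, 5)); case: s {at_hex};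
       rewrite ?hex_edges_left ?inE ?eqxx ?orbT.
  + by apply: (at_hex i (4 * i + 3, 5)); case: s {at_hex};
       rewrite ?hex_edges_right ?inE ?eqxx ?orbT.
  + by apply: (at_hex i (4 * i + 3, 5)); case: s {at_hex};
       rewrite ?hex_edges_right ?inE ?eqxx ?orbT.
  all: apply: (at_hex i (4 * i + 2, if s then 8 else 2)) => //; case: s {at_hex};
       by rewrite ?hex_edges_top ?hex_edges_bottom ?inE ?eqxx ?orbT.
Qed.

Lemma hex_vertices_left n i : map (@to_vertex n) (hex_vertices (4 * i + 1, 5)) =
  [:: vt n (i, JoinL true); vt n (i, Center true); vt n (i, Center false);
      vt n (i, JoinL false); vt n (i, Col false); vt n (i, Col true)].
Proof. by rewrite /vt /= addn1 addn2. Qed.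

Lemma hex_vertices_right n i : map (@to_vertex n) (hex_vertices (4 * i + 3, 5)) =
  [:: vt n (i, JoinR true); vt n (i.+1, Col true); vt n (i.+1, Col false);
      vt n (i, JoinR false); vt n (i, Center false); vt n (i, Center true)].
Proof. by rewrite /vt /= addn3 addn2 mulnS. Qed.

Lemma hex_vertices_top n i : map (@to_vertex n) (hex_vertices (4 * i + 2, 8)) =
  [:: vt n (i, Apex true); vt n (i, ShoulderR true); vt n (i, JoinR true);
      vt n (i, Center true); vt n (i, JoinL true); vt n (i, ShoulderL true)].
Proof. by rewrite /vt /= addn3 addn2 addn1. Qed.

Lemma hex_vertices_bottom n i : map (@to_vertex n) (hex_vertices (4 * i + 2, 2)) =
  [:: vt n (i, Center false); vt n (i, JoinR false); vt n (i, ShoulderR false);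
      vt n (i, Apex false); vt n (i, ShoulderL false); vt n (i, JoinL false)].
Proof. by rewrite /vt /= addn3 addn2 addn1. Qed.

Lemma pyrene_VP n v : reflect (exists2 p, vvalid n p & v = vt n p) (v \in pyrene_V n).
Proof.
apply: (iffP (in_bigcup_seq _ _ _)).
- case=> c /pyrene_centersP[i lt_in].
  have n0 : 0 < n by apply: leq_ltn_trans lt_in.
  rewrite !inE => /or4P[]/eqP->;
    rewrite ?hex_vertices_left ?hex_vertices_right ?hex_vertices_top ?hex_vertices_bottom !inE;
    do 5?[case/orP]; move=> /eqP->; (eexists; last by reflexivity);
    by rewrite /vvalid n0 //= ltnW.
- case=> -[i k] /andP[n0 lt_in] ->.
  have at_hex (j : nat) (c : nat * nat) : j < n ->
      c \in [:: (4 * j + 1, 5); (4 * j + 3, 5); (4 * j + 2, 8); (4 * j + 2, 2)] ->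
      vt n (i, k) \in map (@to_vertex n) (hex_vertices c) ->
      exists2 c, c \in pyrene_centers n &
        vt n (i, k) \in [set v in map (@to_vertex n) (hex_vertices c)].
    by move=> lt_jn cj ec; exists c; rewrite ?inE //; apply/pyrene_centersP; exists j.
  case: k lt_in at_hex => s /= lt_in at_hex.
  + move: lt_in; rewrite leq_eqVlt => /orP[/eqP ein|lt_in].
      have e1 : i = i.-1.+1 by lia.
      by apply: (at_hex i.-1 (4 * i.-1 + 3, 5));
         rewrite ?hex_vertices_right -?e1 ?inE ?eqxx ?orbT //; case: s {at_hex};
         rewrite ?eqxx ?orbT //; lia.
    by apply: (at_hex i (4 * i + 1, 5)); case: s {at_hex};
       rewrite ?hex_vertices_left ?inE ?eqxx ?orbT.
  all: apply: (at_hex i (4 * i + 2, if s then 8 else 2)) => //; case: s {at_hex};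
       by rewrite ?hex_vertices_top ?hex_vertices_bottom ?inE ?eqxx ?orbT.
Qed.

Definition incident (n : nat) (p : nat * vkind) : seq {set pyr_vertex n} :=
  let: (i, k) := p in
  match k with
  | Col s => (if 0 < i then [:: ed n i.-1 (ArmR s)] else [::]) ++
             (if i < n then [:: ed n i (ArmL s)] else [::]) ++ [:: ed n i Rung]
  | JoinL s => [:: ed n i (ArmL s); ed n i (InnerL s); ed n i (SideL s)]
  | Center s => [:: ed n i (InnerL s); ed n i (InnerR s); ed n i Mid]
  | JoinR s => [:: ed n i (InnerR s); ed n i (ArmR s); ed n i (SideR s)]
  | ShoulderL s => [:: ed n i (SideL s); ed n i (TopL s)]
  | Apex s => [:: ed n i (TopL s); ed n i (TopR s)]
  | ShoulderR s => [:: ed n i (TopR s); ed n i (SideR s)]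
  end.

Lemma incidentP n p e : vvalid n p -> e \in pyrene_E n ->
  (vt n p \in e) = (e \in incident n p).
Proof.
move=> hp /pyrene_EP[j [l [hl ->]]]; apply/idP/idP.
- move=> /(in_ed hl hp); move: hl => /andP[_].
  case: l => [||s|s|s|s|s|s|s|s] /= lt_jn [] -> /=; rewrite ?mem_cat ?inE ?eqxx ?orbT //.
  by rewrite lt_jn inE eqxx ?orbT.
- move: {hl} (ed n j l) => f.
  case: p hp => i k; case: k => s hp /=; rewrite ?mem_cat; last first.
  all: try by rewrite !inE; do 2?[case/orP]; move=> /eqP ->; rewrite !inE eqxx ?orbT.
  + rewrite !inE; do 2?[case/orP]; move=> /eqP ->; rewrite !inE ?eqxx ?orbT //.
    by case: s {hp}; rewrite eqxx ?orbT.
  + case/or3P.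
    * by case: i hp => //= i _; rewrite inE => /eqP ->; rewrite !inE eqxx orbT.
    * by case: ifP => // _; rewrite inE => /eqP ->; rewrite !inE eqxx.
    * by rewrite inE => /eqP ->; rewrite !inE; case: s {hp}; rewrite eqxx ?orbT.
Qed.

Lemma ed_eqE n i k j l : evalid n i k -> evalid n j l -> (i, k) <> (j, l) ->
  (ed n i k == ed n j l) = false.
Proof. by move=> h1 h2 neq; apply/eqP => /(ed_inj h1 h2). Qed.

Lemma incident_uniq n p : vvalid n p -> uniq (incident n p).
Proof.
case: p => i k; rewrite /vvalid => /andP[n0]; case: k => s /= hi;
  try by rewrite /= ?inE !ed_eqE // /evalid n0.
rewrite /=; case: i hi => [|i] hi /=; case: ifP => h //=;
  rewrite ?inE ?ed_eqE // /evalid ?n0 ?h //= ?(ltnW hi) // => -[] //; lia.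
Qed.

Lemma perfect_matchingP n (M : {set {set pyr_vertex n}}) : M \subset pyrene_E n ->
  reflect (forall p, vvalid n p -> count [in M] (incident n p) = 1)
    (perfect_matching (pyrene_V n) (pyrene_E n) M).
Proof.
move=> sME; rewrite /perfect_matching sME /=.
have cardE p : vvalid n p -> #|[set e in M | vt n p \in e]| = count [in M] (incident n p).
  move=> hp; rewrite -size_filter -(card_uniqP (filter_uniq _ (incident_uniq hp))).
  apply: eq_card => e; rewrite !inE mem_filter; case eM: (e \in M) => //=.
  by rewrite incidentP // (subsetP sME).
apply: (iffP forall_inP) => [H p hp | H v /pyrene_VP[p hp ->]].
- by rewrite -cardE //; apply/eqP/H/pyrene_VP; exists p.
- by rewrite cardE // H.
Qed.

(* inl true is A, inl false is B, and inr (u, d) is N(u,d), where true selects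
   InnerL and false InnerR. *)
Definition letter : finType := (bool + bool * bool)%type.

Definition LA : letter := inl true.
Definition LB : letter := inl false.
Definition LN (u d : bool) : letter := inr (u, d).

Definition lett (w : seq letter) (i : nat) : letter := nth (LN true true) w i.
Arguments lett : simpl never.

Definition frag (x : letter) (k : ekind) : bool :=
  match k with
  | Rung => false
  | Mid => if x is inl _ then true else false
  | ArmL _ => x == LA
  | ArmR _ => x == LB
  | InnerL s => if x is inr (u, d) then (if s then u else d) else false
  | InnerR s => if x is inr (u, d) then ~~ (if s then u else d) else false
  | TopL s | SideR s =>
      match x with inl a => a | inr (u, d) => if s then u else d end
  | TopR s | SideL s =>
      match x with inl a => ~~ a | inr (u, d) => ~~ (if s then u else d) end
  end.

Definition used (w : seq letter) (i : nat) (k : ekind) : bool :=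
  if k is Rung then (lett w i != LA) && ((i == 0) || (lett w i.-1 != LB))
  else frag (lett w i) k.

Definition ekinds : seq ekind :=
  [:: Rung; Mid] ++
  flatten [seq [:: ArmL s; InnerL s; InnerR s; ArmR s; SideL s; TopL s; TopR s; SideR s]
          | s <- [:: true; false]].

Definition matching (n : nat) (w : seq letter) : {set {set pyr_vertex n}} :=
  [set e | [exists i : 'I_n.+1,
    has (fun k => [&& evalid n i k, used w i k & e == ed n i k]) ekinds]].

Definition compat : rel letter := fun x y => ~~ ((x == LB) && (y == LA)).

Definition good (w : seq letter) : bool := sorted compat w.

Lemma has_exists (T : Type) (p : pred T) (s : seq T) : has p s -> exists x, p x.
Proof. by elim: s => //= x s IH /orP[px|/IH//]; exists x. Qed.

Lemma has_ekinds (p : pred ekind) k : p k -> has p ekinds.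
Proof. by case: k => [||s|s|s|s|s|s|s|s] /=; try case: s => /=; move=> ->; rewrite ?orbT. Qed.

Lemma evalid_le n i k : evalid n i k -> i < n.+1.
Proof. by case: k => [||s|s|s|s|s|s|s|s]; rewrite /evalid => /andP[_] //= /ltnW. Qed.

Lemma matchingP n w e :
  reflect (exists i k, [/\ evalid n i k, used w i k & e = ed n i k]) (e \in matching n w).
Proof.
rewrite inE; apply: (iffP existsP) => [[i /has_exists[k /and3P[h1 h2 /eqP h3]]]|].
  by exists i, k.
case=> i [k [h1 h2 h3]]; exists (Ordinal (evalid_le h1)).
by apply: (has_ekinds (k := k)); rewrite /= h1 h2 h3 eqxx.
Qed.

Lemma in_matching n w i k : evalid n i k -> (ed n i k \in matching n w) = used w i k.
Proof.
move=> h; apply/matchingP/idP => [[j [l [hl ul /(ed_inj h hl)[-> ->]]]] //|u].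
by exists i, k.
Qed.

Lemma matching_sub n w : matching n w \subset pyrene_E n.
Proof. by apply/subsetP => e /matchingP[i [k [h1 _ ->]]]; apply/pyrene_EP; exists i, k. Qed.

Lemma letterE (x y : letter) :
  (forall s, frag x (ArmL s) = frag y (ArmL s)) ->
  (forall s, frag x (ArmR s) = frag y (ArmR s)) ->
  (forall s, frag x (InnerL s) = frag y (InnerL s)) -> x = y.
Proof.
move=> h1 h2 h3; have := (h1 true, h2 true, h3 true, h3 false).
by case: x {h1 h2 h3} => [[]|[[] []]]; case: y => [[]|[[] []]] /= [[[]]].
Qed.

Lemma matching_inj n w w' : size w = n -> size w' = n ->
  matching n w = matching n w' -> w = w'.
Proof.
move=> s1 s2 E; apply: (@eq_from_nth _ (LN true true)); first by rewrite s1.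
move=> i; rewrite s1 => lt_in; have n0 : 0 < n by lia.
have H k : (if k is Rung then False else True) ->
    frag (lett w i) k = frag (lett w' i) k.
  move=> nk; have hk : evalid n i k by case: k nk => //= *; rewrite /evalid n0.
  by move: (in_matching w hk); rewrite E in_matching //; case: k nk {hk}.
by apply: letterE => s; apply: H.
Qed.

Lemma goodP w :
  reflect (forall i, lett w i = LB -> lett w i.+1 = LA -> False) (good w).
Proof.
apply: (iffP (sortedP (LN true true))) => [H i h1 h2|H i _].
  have lt : i.+1 < size w.
    by rewrite ltnNge; apply/negP => le; move: h2; rewrite /lett nth_default.
  by have := H _ lt; rewrite /compat -!/(lett _ _) h1 h2.
by apply/negP => /andP[/eqP h1 /eqP h2]; apply: (H i).
Qed.

Lemma matching_perfect n w : size w = n -> good w ->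
  perfect_matching (pyrene_V n) (pyrene_E n) (matching n w).
Proof.
move=> sw /goodP gw; apply/(perfect_matchingP (matching_sub n w)) => -[i k].
rewrite /vvalid /= => /andP[n0]; case: k => s /= hi; last first.
all: try by rewrite !in_matching ?/evalid ?n0 //= /used;
  case: (lett w i) => [[]|[[] []]]; case: s.
rewrite !count_cat /= in_matching ?/evalid ?n0 //=.
have -> : count [in matching n w] (if i < n then [:: ed n i (ArmL s)] else [::]) =
          (lett w i == LA).
  case: ltnP => h /=; first by rewrite in_matching ?/evalid ?n0 //= addn0.
  by rewrite /lett nth_default // sw.
case: i hi => [|i] hi /=; first by case: eqP.
rewrite in_matching ?/evalid ?n0 //=.
case e1: (lett w i == LB); case e2: (lett w i.+1 == LA) => //=.
by case: (gw i (eqP e1) (eqP e2)).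
Qed.

Definition letter_of (f : ekind -> bool) : letter :=
  if f (ArmL true) then LA else if f (ArmR true) then LB
  else LN (f (InnerL true)) (f (InnerL false)).

(* The two halves of a fragment are only linked by Mid, which is used exactly
   when one of the two arms is; so if they agree on the left arm, they agree on
   the right arm. *)
Lemma fragE (f : ekind -> bool) :
  (forall s, f (SideL s) + f (TopL s) = 1) ->
  (forall s, f (TopL s) + f (TopR s) = 1) ->
  (forall s, f (TopR s) + f (SideR s) = 1) ->
  (forall s, f (ArmL s) + (f (InnerL s) + f (SideL s)) = 1) ->
  (forall s, f (InnerL s) + (f (InnerR s) + f Mid) = 1) ->
  (forall s, f (InnerR s) + (f (ArmR s) + f (SideR s)) = 1) ->
  f (ArmL true) = f (ArmL false) ->
  forall k, (if k is Rung then False else True) -> f k = frag (letter_of f) k.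
Proof.
move=> h1 h2 h3 h4 h5 h6 h7 k nk.
have := (h1 true, h1 false, h2 true, h2 false, h3 true, h3 false).
have := (h4 true, h4 false, h5 true, h5 false, h6 true, h6 false, h7).
rewrite /letter_of => {h1 h2 h3 h4 h5 h6 h7} [[[[[[[]]]]]]].
move=> + + + + + + + [[[[[]]]]].
case: k nk => [||s|s|s|s|s|s|s|s] //= _; try case: s => /=.
all: case: (f (ArmL true)); case: (f (ArmL false)) => //.
all: case: (f (SideL true)); case: (f (InnerL true)) => //.
all: case: (f (SideL false)); case: (f (InnerL false)) => //.
all: case: (f (TopL true)); case: (f (TopL false)) => //.
all: case: (f (TopR true)); case: (f (TopR false)) => //.
all: case: (f (SideR true)); case: (f (SideR false)) => //.
all: case: (f (ArmR true)); case: (f (InnerR true)) => //.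
all: case: (f (ArmR false)); case: (f (InnerR false)) => //.
all: by case: (f Mid).
Qed.

Lemma perfect_matching_word n M : perfect_matching (pyrene_V n) (pyrene_E n) M ->
  exists w, [/\ size w = n, good w & M = matching n w].
Proof.
move=> pM; have sME : M \subset pyrene_E n by case/andP: pM.
move/(perfect_matchingP sME): pM => pM.
pose m i k := ed n i k \in M.
have arms i : i < n -> m i (ArmL true) = m i (ArmL false) ->
    forall k, (if k is Rung then False else True) -> m i k = frag (letter_of (m i)) k.
  move=> lt_in; have n0 : 0 < n by lia.
  have at_v k : (if k is Col _ then False else True) ->
      count [in M] (incident n (i, k)) = 1.
    by move=> nk; apply: pM; rewrite /vvalid n0; case: k nk.
  by apply: fragE => s;
    [move: (at_v (ShoulderL s) I) | move: (at_v (Apex s) I) | move: (at_v (ShoulderR s) I)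
    | move: (at_v (JoinL s) I) | move: (at_v (Center s) I) | move: (at_v (JoinR s) I)];
    rewrite /= addn0.
have colE i s : 0 < n -> i <= n ->
    (if 0 < i then m i.-1 (ArmR s) else false) +
    ((if i < n then m i (ArmL s) else false) + m i Rung) = 1.
  move=> n0 le_in; have := pM (i, Col s); rewrite /vvalid n0 /= !count_cat /= addn0.
  by move=> /(_ le_in); do 2!case: ifP => _; rewrite /= ?addn0.
have sym i : i < n -> m i (ArmL true) = m i (ArmL false).
  elim: i => [|i IH] lt_in; have n0 : 0 < n by lia.
    have := colE 0 true n0 isT; have := colE 0 false n0 isT; rewrite /= n0.
    by case: (m 0 (ArmL true)); case: (m 0 (ArmL false)); case: (m 0 Rung).
  have lt_i : i < n by lia.
  have E : m i (ArmR true) = m i (ArmR false) by rewrite !(arms i lt_i (IH lt_i)).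
  have := colE i.+1 true n0 (ltnW lt_in); have := colE i.+1 false n0 (ltnW lt_in).
  rewrite /= lt_in -E.
  by case: (m i (ArmR true)); case: (m i.+1 (ArmL true));
     case: (m i.+1 (ArmL false)); case: (m i.+1 Rung).
pose w := mkseq (fun i => letter_of (m i)) n.
have sw : size w = n by rewrite size_mkseq.
have lettE i : i < n -> lett w i = letter_of (m i) by move=> h; rewrite /lett nth_mkseq.
have ArmLE i : 0 < n -> i <= n -> (if i < n then m i (ArmL true) else false) = (lett w i == LA).
  move=> n0 le_in; case: ltnP => h; first by rewrite lettE // (arms i h (sym i h)).
  by rewrite /lett nth_default // sw.
have ArmRE i : 0 < n -> i <= n ->
    (if 0 < i then m i.-1 (ArmR true) else false) = ~~ ((i == 0) || (lett w i.-1 != LB)).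
  case: i => [|i] //= n0 h; first by rewrite lettE // (arms i h (sym i h)) //= negbK.
have rungE i : 0 < n -> i <= n ->
  ~~ ((i == 0) || (lett w i.-1 != LB)) + ((lett w i == LA) + m i Rung) = 1.
  by move=> n0 h; rewrite -ArmLE // -ArmRE // colE.
exists w; split=> //.
- apply/goodP => i h1 h2.
  have lt_in : i.+1 < n.
    by rewrite ltnNge; apply/negP => le; move: h2; rewrite /lett nth_default ?sw.
  by have := rungE i.+1 (leq_ltn_trans (leq0n _) lt_in) (ltnW lt_in); rewrite h2 [i.+1.-1]/= h1.
- apply/setP => e; case eE: (e \in pyrene_E n); last first.
    by apply/idP/idP => [/(subsetP sME)|/(subsetP (matching_sub n w))]; rewrite eE.
  case/pyrene_EP: eE => i [k [hk ->]]; rewrite in_matching // -/(m i k) /used.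
  move: hk => /andP[n0 hi]; case: k hi => [hi|hi|s hi|s hi|s hi|s hi|s hi|s hi|s hi|s hi].
    have := rungE i n0 hi.
    by case: (lett w i == LA); case: (_ || _); case: (m i Rung).
  all: by rewrite lettE // -(arms i hi (sym i hi)).
Qed.

Definition weight_letter (x : letter) : nat :=
  if x is inr (u, d) then 2 + (u == d) else 1.

Definition weight (w : seq letter) : nat := sumn (map weight_letter w).

Lemma weightE n w : size w = n -> weight w = sumn [seq weight_letter (lett w i) | i <- iota 0 n].
Proof.
by move=> <-; rewrite /weight -{1}(mkseq_nth (LN true true) w) /mkseq -map_comp.
Qed.

Definition cut (n : nat) (w : seq letter) (i : nat) : seq {set pyr_vertex n} :=
  match lett w i with
  | inl a => [:: ed n (if a then i else i.+1) Rung]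
  | inr (u, d) => [:: ed n i (if u then TopR true else TopL true);
                      ed n i (if d then TopR false else TopL false)] ++
                  (if u == d then [:: ed n i Mid] else [::])
  end.

Definition cutset (n : nat) (w : seq letter) : {set {set pyr_vertex n}} :=
  [set e in flatten [seq cut n w i | i <- iota 0 n]].

Lemma card_cutset n w : size w = n -> #|cutset n w| <= weight w.
Proof.
move=> sw; rewrite (weightE sw) cardsE (leq_trans (card_size _)) // size_flatten /shape -map_comp.
rewrite (@eq_map _ _ _ (fun i => weight_letter (lett w i))) // => i.
by rewrite /= /cut; case: (lett w i) => [|[u d]] //=; case: (u == d).
Qed.

Lemma cut_unused n w i e : i < n -> e \in cut n w i ->
  exists j k, [/\ evalid n j k, ~~ used w j k & e = ed n j k].
Proof.
move=> lt_in; have n0 : 0 < n by lia.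
have v k : evalid n i k by rewrite /evalid n0; case: k => //=; apply: ltnW.
rewrite /cut; case E: (lett w i) => [[]|[u d]].
- by rewrite inE => /eqP ->; exists i, Rung; rewrite v /used E.
- rewrite inE => /eqP ->; exists i.+1, Rung; split=> //; last by rewrite /used /= E andbF.
  by rewrite /evalid n0.
- rewrite mem_cat !inE => /orP[/orP[]/eqP->|].
  + by exists i, (if u then TopR true else TopL true); split=> //; rewrite /used; case: u E => /= ->.
  + by exists i, (if d then TopR false else TopL false); split=> //; rewrite /used; case: d E => /= ->.
  + case: ifP => // _; rewrite inE => /eqP ->.
    by exists i, Mid; rewrite v /used E.
Qed.

(* Deleting the rung on the open side of an A forces an A there, since the
   letter before it cannot be a B; A's are therefore recovered from left to
   right and B's from right to left. *)
Lemma cut_forces n w w' : size w = n -> size w' = n -> good w ->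
  (forall i e, i < n -> e \in cut n w i -> e \notin matching n w') -> w' = w.
Proof.
move=> sw sw' /goodP gw H.
have unused i j k : i < n -> evalid n j k -> ed n j k \in cut n w i -> used w' j k = false.
  by move=> h1 h2 /(H _ _ h1); rewrite in_matching // => /negbTE.
have keepN i u d : lett w i = LN u d -> lett w' i = LN u d.
  move=> E; case: (ltnP i n) => [lt_in|le]; last first.
    by move: E; rewrite /lett !nth_default ?sw ?sw'.
  have n0 : 0 < n by lia.
  have v k : evalid n i k by rewrite /evalid n0; case: k => //=; apply: ltnW.
  have h1 : used w' i (if u then TopR true else TopL true) = false.
    by apply: (unused i) => //; rewrite /cut E mem_cat !inE eqxx.
  have h2 : used w' i (if d then TopR false else TopL false) = false.
    by apply: (unused i) => //; rewrite /cut E mem_cat !inE eqxx orbT.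
  have h3 : u = d -> used w' i Mid = false.
    by move=> ud; apply: (unused i) => //; rewrite /cut E /= ud eqxx !inE eqxx !orbT.
  move: h1 h2 h3 {E}; rewrite /used.
  by case: u; case: d; case: (lett w' i) => [[]|[[] []]] //= _ _ /(_ erefl).
have ltA i : lett w i = LA -> i < n.
  by move=> E; rewrite ltnNge; apply/negP => le; move: E; rewrite /lett nth_default ?sw.
have keepA i : lett w i = LA -> lett w' i = LA.
  have rung_off j : lett w j = LA -> used w' j Rung = false.
    move=> E; have lt_jn := ltA _ E; have n0 : 0 < n by lia.
    by apply: (unused j); rewrite ?/evalid ?n0 ?(ltnW lt_jn) // /cut E inE.
  elim: i => [|i IH] E; have := rung_off _ E; rewrite /used; case: eqP => //= _.
  case: eqP => //= B' _; exfalso.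
  case Ei: (lett w i) => [[]|[u d]].
  - by move: B'; rewrite IH.
  - exact: gw Ei E.
  - by move: B'; rewrite (keepN _ _ _ Ei).
have keepB k i : i + k = n -> lett w i = LB -> lett w' i = LB.
  elim: k i => [|k IH] i ik E.
    by move: E; rewrite /lett nth_default // sw -ik addn0.
  have lt_in : i < n by lia.
  have n0 : 0 < n by lia.
  have := unused i i.+1 Rung lt_in; rewrite /cut E inE eqxx /evalid n0 lt_in.
  move=> /(_ isT isT); rewrite /used /=; case: (lett w' i =P LB) => //= _; rewrite andbT.
  case: eqP => //= A' _; exfalso.
  case Ei: (lett w i.+1) => [[]|[u d]].
  - exact: gw E Ei.
  - by move: A'; rewrite IH // addSnnS.
  - by move: A'; rewrite (keepN _ _ _ Ei).
apply: (@eq_from_nth _ (LN true true)) => [|i]; rewrite sw' // => lt_in.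
rewrite -!/(lett _ _); case E: (lett w i) => [[]|[u d]].
- exact: keepA.
- by apply: (keepB (n - i)) => //; lia.
- exact: keepN.
Qed.

Lemma cutset_anti_forcing n w : size w = n -> good w ->
  anti_forcing_set (pyrene_V n) (pyrene_E n) (matching n w) (cutset n w).
Proof.
move=> sw gw; apply/andP; split.
  apply/subsetP => e; rewrite inE => /flatten_mapP[i]; rewrite mem_iota => lt_in.
  move=> /(cut_unused lt_in)[j [k [hk uk ->]]].
  by rewrite inE in_matching // uk; apply/pyrene_EP; exists j, k.
apply/forallP => M; apply/implyP => /andP[sM pM].
have sME : M \subset pyrene_E n by apply: subset_trans sM _; apply: subsetDl.
have [|w' [sw' gw' EM]] := @perfect_matching_word n M; first by apply/andP.
rewrite EM; apply/eqP; congr matching; apply: cut_forces sw sw' gw _ => i e lt_in ei.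
apply/negP; rewrite -EM => /(subsetP sM); rewrite !inE => /andP[/negP[]].
by apply/flatten_mapP; exists i; rewrite // mem_iota.
Qed.

Definition upd (w : seq letter) (i : nat) (x : letter) : seq letter :=
  set_nth (LN true true) w i x.
Arguments upd : simpl never.

Lemma lett_upd w i x j : lett (upd w i x) j = if j == i then x else lett w j.
Proof. by rewrite /lett /upd nth_set_nth. Qed.

Lemma size_upd w i x : i < size w -> size (upd w i x) = size w.
Proof. by move=> h; rewrite size_set_nth; apply/maxn_idPr. Qed.

(* The other matching attached to the unit t of the letter i.  When a B precedes
   N(true,true), turning the latter into A requires replacing this B too. *)
Definition alt (w : seq letter) (i t : nat) : seq letter :=
  match lett w i with
  | inl a => upd w i (LN (~~ a) (~~ a))
  | inr (u, d) =>
      if t == 0 then upd w i (LN (~~ u) d)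
      else if t == 1 then upd w i (LN u (~~ d))
      else if u then
        upd (if (0 < i) && (lett w i.-1 == LB) then upd w i.-1 (LN false false) else w) i LA
      else upd (if lett w i.+1 == LA then upd w i.+1 (LN true true) else w) i LB
  end.

(* The unit of weight an edge is charged to: any edge gained by alt w i t has
   label (i, t). *)
Definition label (w : seq letter) (j : nat) (k : ekind) : nat * nat :=
  match k with
  | Rung => if lett w j == LA then (j, 0) else (j.-1, 0)
  | Mid | ArmL _ | ArmR _ => (j, 2)
  | InnerL s =>
      match lett w j with
      | inl a => if a then (j.-1, 2) else (j, 0)
      | inr _ => (j, if s then 0 else 1)
      end
  | InnerR s =>
      match lett w j with
      | inl a => if a then (j, 0) else (j.+1, 2)
      | inr _ => (j, if s then 0 else 1)
      end
  | SideL s | TopL s | TopR s | SideR s =>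
      (j, if lett w j is inr _ then (if s then 0 else 1) else 0)
  end.

Lemma lett_out w i : size w <= i -> lett w i = LN true true.
Proof. exact: nth_default. Qed.

Lemma size_alt w i t : i < size w -> size (alt w i t) = size w.
Proof.
move=> lt_i; rewrite /alt; case: (lett w i) => [a|[u d]]; first exact: size_upd.
do 2![case: ifP => _; first exact: size_upd].
case: ifP => _; case: ifP => h; rewrite ?size_upd //.
- by lia.
- by lia.
- by rewrite ltnNge; apply/negP => /lett_out e; rewrite e in h.
- by rewrite ltnNge; apply/negP => /lett_out e; rewrite e in h.
Qed.

Lemma good_alt w i t : i < size w -> good w -> good (alt w i t).
Proof.
move=> lt_i /goodP gw; apply/goodP => j; rewrite /alt.
have gN x y : lett (upd w i (LN x y)) j = LB -> lett (upd w i (LN x y)) j.+1 = LA -> False.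
  by rewrite !lett_upd; do 2!case: ifP => // _; apply: gw.
case: (lett w i) => [a|[u d]]; first exact: gN.
case: ifP => _; first exact: gN.
case: ifP => _; first exact: gN.
case: u.
- rewrite !lett_upd; case: eqP => // ji; case: ifP => [/andP[i0 _]|h].
    rewrite !lett_upd; case: (j =P i.-1) => // ji1.
    have -> : (j.+1 == i) = false by lia.
    by case: ifP => // _; apply: gw.
  case: eqP => [ji1|_]; last exact: gw.
  by move: h; rewrite -ji1 /= => /eqP h1 h2; case: h1.
- rewrite !lett_upd; case: (lett w i.+1 =P LA) => h.
    rewrite !lett_upd; case: (j =P i) => [->|ji]; first by rewrite eqxx; case: eqP.
    case: eqP => // _; case: eqP => // _; case: eqP => // _; exact: gw.
  case: (j =P i) => [->|ji]; first by case: eqP.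
  by case: eqP => // _; apply: gw.
Qed.

Lemma alt_neq w i t : i < size w -> alt w i t <> w.
Proof.
move=> lt_i /(congr1 (lett^~ i)); rewrite /alt; case E: (lett w i) => [a|[u d]].
  by rewrite lett_upd eqxx.
case: ifP => _; first by rewrite lett_upd eqxx => -[]; case: u {E}.
case: ifP => _; first by rewrite lett_upd eqxx => -[]; case: d {E}.
by case: u {E}; rewrite lett_upd eqxx.
Qed.

Lemma alt_label_rung w i t j : t < weight_letter (lett w i) -> good w ->
  used (alt w i t) j Rung -> ~~ used w j Rung -> label w j Rung = (i, t).
Proof.
move=> lt_t /goodP gw; rewrite /used /label negb_and negbK negb_or negbK /alt.
move=> /andP[nA nB] /orP[/eqP A|/andP[j0 /eqP B]].
- rewrite A eqxx; case: (j =P i) => [ji|ji].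
    by move: lt_t; rewrite -ji A ltnS leqn0 => /eqP ->.
  exfalso; move: nA nB; case E: (lett w i) lt_t => [a|[u d]] lt_t.
    by rewrite lett_upd; case: (j =P i) => // _; rewrite A.
  case: ifP => _; first by rewrite lett_upd; case: (j =P i) => // _; rewrite A.
  case: ifP => _; first by rewrite lett_upd; case: (j =P i) => // _; rewrite A.
  case: u {E lt_t}.
    rewrite lett_upd; case: (j =P i) => // _; case: ifP => h; last by rewrite A.
    rewrite lett_upd; case: (j =P i.-1) => [ji1|]; last by rewrite A.
    by move: h; rewrite -ji1 A andbF.
  rewrite lett_upd; case: (j =P i) => // _; case: ifP => h; last by rewrite A.
  rewrite lett_upd; case: (j =P i.+1) => [->|]; last by rewrite A.
  by rewrite lett_upd eqxx.
- have jE : j = j.-1.+1 by lia.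
  have -> : (lett w j == LA) = false.
    by apply/eqP => A; rewrite jE in A; apply: gw B A.
  case: (j.-1 =P i) => [ji|ji].
    by move: lt_t; rewrite -ji B ltnS leqn0 => /eqP ->.
  exfalso; move: nA nB; rewrite (negbTE j0) /=; case E: (lett w i) lt_t => [a|[u d]] lt_t.
    by rewrite !lett_upd; case: (j.-1 =P i) => //; rewrite B.
  case: ifP => _; first by rewrite !lett_upd; case: (j.-1 =P i) => //; rewrite B.
  case: ifP => _; first by rewrite !lett_upd; case: (j.-1 =P i) => //; rewrite B.
  case: u {E lt_t}.
    rewrite !lett_upd; case: (j =P i) => // ji2.
    case: (j.-1 =P i) => // _; case: ifP => h; last by rewrite B.
    rewrite !lett_upd; case: (j.-1 =P i.-1) => [ji1|]; last by rewrite B.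
    by exfalso; lia.
  rewrite !lett_upd; case: (j.-1 =P i) => // _.
  case: (lett w i.+1 =P LA) => h; last by rewrite B.
  rewrite !lett_upd; case: (j.-1 =P i.+1) => [ji1|]; last by rewrite B.
  by move: h; rewrite -ji1 B.
Qed.

Variant change : nat -> nat -> nat -> letter -> letter -> Prop :=
  | ChangeNone i t j x : change i t j x x
  | ChangeArm i a : change i 0 i (inl a) (LN (~~ a) (~~ a))
  | ChangeUp i u d : change i 0 i (LN u d) (LN (~~ u) d)
  | ChangeDown i u d : change i 1 i (LN u d) (LN u (~~ d))
  | ChangeBoth i u : change i 2 i (LN u u) (inl u)
  | ChangePrev j : change j.+1 2 j LB (LN false false)
  | ChangeNext i : change i 2 i.+1 LA (LN true true).

Lemma alt_change w i t j : t < weight_letter (lett w i) ->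
  change i t j (lett w j) (lett (alt w i t) j).
Proof.
rewrite /alt; case E: (lett w i) => [a|[u d]].
  rewrite ltnS leqn0 => /eqP ->; rewrite lett_upd; case: (j =P i) => [->|_].
    by rewrite E; constructor.
  by constructor.
case: (t =P 0) => [-> _|t0].
  by rewrite lett_upd; case: (j =P i) => [->|_]; rewrite ?E; constructor.
case: (t =P 1) => [-> _|t1].
  by rewrite lett_upd; case: (j =P i) => [->|_]; rewrite ?E; constructor.
rewrite /= => lt_t; have t2 : t = 2 by move: lt_t; case: (u == d); lia.
have ud : u = d by apply/eqP; move: lt_t; rewrite t2; case: (u == d).
rewrite t2 -ud in E *; case: u {ud lt_t} E => E; rewrite lett_upd.
- case: (j =P i) => [->|_]; first by rewrite E; constructor.
  case: andP => [[i0 /eqP B]|_]; last by constructor.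
  rewrite lett_upd; case: (j =P i.-1) => [ji|_]; last by constructor.
  have -> : i = j.+1 by lia.
  by rewrite ji B; constructor.
- case: (j =P i) => [->|_]; first by rewrite E; constructor.
  case: (lett w i.+1 =P LA) => [A|_]; last by constructor.
  rewrite lett_upd; case: (j =P i.+1) => [->|_]; last by constructor.
  by rewrite A; constructor.
Qed.

Lemma alt_label w i t j k : t < weight_letter (lett w i) -> good w ->
  used (alt w i t) j k -> ~~ used w j k -> label w j k = (i, t).
Proof.
move=> lt_t gw; have := alt_label_rung (j := j) lt_t gw.
case: k => [//||s|s|s|s|s|s|s|s] _; have := alt_change j lt_t; rewrite /used /label.
all: case=> [? ? ? ? ->|? []|? [] []|? [] []|? []|?|?] //=; by case: s.
Qed.

Lemma leq_card_labels (T : finType) (U : eqType) (lab : T -> U -> Prop) (l : seq U)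
    (S : {set T}) :
  uniq l -> (forall e u v, lab e u -> lab e v -> u = v) ->
  (forall u, u \in l -> exists2 e, e \in S & lab e u) -> size l <= #|S|.
Proof.
move=> + lab_fun; elim: l S => //= u l IH S /andP[ul uniql] hit.
have [e eS eu] := hit u (mem_head u l).
rewrite (cardsD1 e) eS ltnS; apply: IH => // v vl.
have [|f fS fv] := hit v; first by rewrite inE vl orbT.
exists f => //; rewrite !inE fS andbT; apply/eqP => fe.
by move: ul; rewrite (lab_fun e u v) ?vl // -fe.
Qed.

Lemma anti_forcing_lower n w S : size w = n -> good w ->
  anti_forcing_set (pyrene_V n) (pyrene_E n) (matching n w) S -> weight w <= #|S|.
Proof.
move=> sw gw /andP[sS /forallP fS].
pose units := [seq (i, t) | i <- iota 0 n, t <- iota 0 (weight_letter (lett w i))].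
have -> : weight w = size units.
  rewrite size_allpairs_dep (weightE sw); congr sumn.
  by apply: eq_map => i; rewrite size_iota.
apply: (@leq_card_labels _ _
  (fun e u => exists j k, [/\ evalid n j k, e = ed n j k & label w j k = u])).
- apply: allpairs_uniq_dep => [|i _|]; try exact: iota_uniq.
  by move=> [i t] [j u] _ _ /= [-> ->].
- move=> e u v [j [k [h -> <-]]] [j' [k' [h' E <-]]].
  by case: (ed_inj h h' E) => -> ->.
- move=> _ /allpairsPdep[i [t [+ + ->]]]; rewrite !mem_iota !add0n => /= lt_in lt_t.
  have lt_i : i < size w by rewrite sw.
  have sa : size (alt w i t) = n by rewrite size_alt.
  have ga := good_alt t lt_i gw.
  case: (boolP [exists e in S, e \in matching n (alt w i t)]).
    case/exists_inP => e eS /matchingP[j [k [h uk eE]]]; exists e => //.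
    exists j, k; split=> //; apply: (alt_label lt_t gw uk).
    by have := subsetP sS _ eS; rewrite inE eE in_matching // => /andP[].
  rewrite negb_exists_in => /forall_inP dis; exfalso.
  have := fS (matching n (alt w i t)).
  have /andP[sE pE] := matching_perfect sa ga.
  have -> : perfect_matching (pyrene_V n) (pyrene_E n :\: S) (matching n (alt w i t)).
    rewrite /perfect_matching pE andbT; apply/subsetP => e eM; rewrite inE (subsetP sE) // andbT.
    by apply/negP => /dis; rewrite eM.
  by move=> /eqP /(matching_inj sa sw); apply: alt_neq.
Qed.

Lemma bigmin_leq (I : eqType) (r : seq I) (P : pred I) (F : I -> nat) (m : nat) i :
  i \in r -> P i -> \big[minn/m]_(j <- r | P j) F j <= F i.
Proof.
move=> + Pi; elim: r => //= j r IH; rewrite inE big_cons => /orP[/eqP <-|/IH le].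
  by rewrite Pi geq_minl.
by case: ifP => // _; apply: leq_trans (geq_minr _ _) le.
Qed.

Lemma anti_forcing_number_matching n w : size w = n -> good w ->
  anti_forcing_number (pyrene_V n) (pyrene_E n) (matching n w) = weight w.
Proof.
move=> sw gw; have afw := cutset_anti_forcing sw gw.
apply/eqP; rewrite eqn_leq; apply/andP; split.
  apply: leq_trans (card_cutset sw).
  exact: (bigmin_leq (fun S : {set {set pyr_vertex n}} => #|S|) _ (mem_index_enum _) afw).
apply: (big_ind (leq (weight w))) => [|x y hx hy|S]; last exact: anti_forcing_lower.
  apply: leq_trans (anti_forcing_lower sw gw afw) (subset_leq_card _).
  by case/andP: afw => /subset_trans + _; apply; apply: subsetDl.
by rewrite leq_min hx.
Qed.

Definition letters : seq letter :=
  [:: LA; LB; LN true true; LN true false; LN false true; LN false false].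

Fixpoint words (n : nat) : seq (seq letter) :=
  if n is m.+1 then
    [seq x :: w | x <- letters, w <- [seq w <- words m | path compat x w]]
  else [:: [::]].
Arguments words : simpl never.

Lemma wordsS n :
  words n.+1 = [seq x :: w | x <- letters, w <- [seq w <- words n | path compat x w]].
Proof. by []. Qed.

Lemma mem_words n w : (w \in words n) = (size w == n) && good w.
Proof.
elim: n w => [|n IH] [|x w] //=; rewrite wordsS.
  by apply/negbTE/negP => /allpairsPdep[x [w [_ _]]].
apply/allpairsPdep/idP => [[y [v [_ + [-> ->]]]]|].
  by rewrite mem_filter IH eqSS => /and3P[-> -> _].
rewrite eqSS => /andP[sw pw]; exists x, w; split=> //.
  by case: x {pw} => [[]|[[] []]].
by rewrite mem_filter IH pw sw; apply: path_sorted pw.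
Qed.

Lemma words_uniq n : uniq (words n).
Proof.
elim: n => // n IH; rewrite wordsS; apply: allpairs_uniq_dep => // [x _|].
  exact: filter_uniq.
by move=> [x v] [y w] _ _ /= [-> ->].
Qed.

Lemma sum_anti_forcing n :
  \sum_(M : {set {set pyr_vertex n}} | perfect_matching (pyrene_V n) (pyrene_E n) M)
      anti_forcing_number (pyrene_V n) (pyrene_E n) M = \sum_(w <- words n) weight w.
Proof.
have inj : {in words n &, injective (matching n)}.
  move=> v w; rewrite !mem_words => /andP[/eqP sv _] /andP[/eqP sw _].
  exact: matching_inj.
transitivity (\sum_(M <- map (matching n) (words n))
    anti_forcing_number (pyrene_V n) (pyrene_E n) M).
  rewrite big_uniq /=; last by rewrite map_inj_in_uniq // words_uniq.
  apply: eq_bigl => M; apply/idP/mapP => [/perfect_matching_word[w [sw gw ->]]|[w]].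
    by exists w => //; rewrite mem_words sw eqxx.
  by rewrite mem_words => /andP[/eqP sw gw] ->; apply: matching_perfect.
rewrite big_map; apply: eq_big_seq => w; rewrite mem_words => /andP[/eqP sw gw].
exact: anti_forcing_number_matching.
Qed.

Lemma sum_words_cons (F : seq letter -> nat) n :
  \sum_(w <- words n.+1) F w =
  \sum_(x <- letters) \sum_(w <- words n | path compat x w) F (x :: w).
Proof. by rewrite wordsS big_allpairs_dep; apply: eq_bigr => x _; rewrite big_filter. Qed.

Lemma path_compatN x w : x != LB -> path compat x w = good w.
Proof. by move=> xB; case: w => //= y w; rewrite /compat (negbTE xB). Qed.

(* Every letter may be prefixed to every word, except B to the words A v. *)
Lemma sum_words_rec (F : seq letter -> nat) n :
  \sum_(w <- words n.+2) F w + \sum_(w <- words n) F [:: LB, LA & w] =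
  \sum_(w <- words n.+1) \sum_(x <- letters) F (x :: w).
Proof.
have good_words m w : w \in words m -> good w by rewrite mem_words => /andP[].
have noB m x : x != LB -> \sum_(w <- words m | path compat x w) F (x :: w) =
                          \sum_(w <- words m) F (x :: w).
  move=> xB; rewrite big_seq_cond [RHS]big_seq; apply: eq_bigl => w.
  by case wm: (w \in words m) => //=; rewrite path_compatN // (good_words _ _ wm).
have BA : \sum_(w <- words n.+1) F (LB :: w) =
    \sum_(w <- words n.+1 | path compat LB w) F (LB :: w) +
    \sum_(w <- words n) F [:: LB, LA & w].
  rewrite (bigID (path compat LB)) /=; congr addn.
  rewrite big_mkcond sum_words_cons /letters !big_cons big_nil addn0.
  rewrite [X in X + _](_ : _ = \sum_(w <- words n) F [:: LB, LA & w]); last first.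
    rewrite big_seq_cond [RHS]big_seq; apply: eq_big => [w|w /andP[wn _]] /=.
      by case wn: (w \in words n) => //=; rewrite path_compatN // (good_words _ _ wn).
    by [].
  have Z x : x != LA ->
      \sum_(w <- words n | path compat x w)
        (if ~~ path compat LB (x :: w) then F [:: LB, x & w] else 0) = 0.
    by move=> xA; apply: big1 => w pw; rewrite /= pw andbT /compat (negbTE xA) andbF.
  by rewrite !Z // !addn0.
rewrite sum_words_cons exchange_big /= /letters !big_cons !big_nil !addn0.
by rewrite BA (noB _ LA) // !(noB _ (LN _ _)) // -addnA; congr addn; rewrite addnAC.
Qed.

Lemma size_words_rec n : size (words n.+2) + size (words n) = 6 * size (words n.+1).
Proof.
rewrite -!sum1_size (sum_words_rec (fun=> 1)) big_distrr /=.
by apply: eq_bigr => w _; rewrite sum1_size.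
Qed.

Lemma weight_words_rec n :
  \sum_(w <- words n.+2) weight w + \sum_(w <- words n) weight w + 2 * size (words n) =
  6 * (\sum_(w <- words n.+1) weight w) + 12 * size (words n.+1).
Proof.
rewrite -addnA -!sum1_size !big_distrr /= -!big_split /=.
have -> : \sum_(w <- words n) (weight w + 2 * 1) = \sum_(w <- words n) weight [:: LB, LA & w].
  by apply: eq_bigr => w _; rewrite /weight /=; lia.
rewrite sum_words_rec; apply: eq_bigr => w _.
by rewrite /letters !big_cons big_nil /weight /=; lia.
Qed.

Import GRing.Theory Num.Theory.
Local Open Scope ring_scope.

Lemma two_step_ind (P : nat -> Prop) :
  P 0 -> P 1 -> (forall n, P n -> P n.+1 -> P n.+2) -> forall n, P n.
Proof.
move=> P0 P1 PS n; suff [] : P n /\ P n.+1 by [].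
by elim: n => [//|n [Pn Pn1]]; split=> //; apply: PS.
Qed.

Lemma pell_exprSS (R : comRingType) (t : R) n : t ^+ 2 = 2 ->
  (3 + 2 * t) ^+ n.+2 = 6 * (3 + 2 * t) ^+ n.+1 - (3 + 2 * t) ^+ n.
Proof.
move=> t2; rewrite !exprS.
have -> : (3 + 2 * t) * ((3 + 2 * t) * (3 + 2 * t) ^+ n) =
  (9 + 12 * t + 4 * t ^+ 2) * (3 + 2 * t) ^+ n by ring.
by rewrite t2; ring.
Qed.

Lemma size_wordsE (F : numFieldType) (s : F) n : s ^+ 2 = 2 -> (size (words n))%:R =
  (4 + 3 * s) / 8 * (3 + 2 * s) ^+ n + (4 - 3 * s) / 8 * (3 - 2 * s) ^+ n :> F.
Proof.
move=> ssq; have mE : 3 - 2 * s = 3 + 2 * - s by ring.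
have p1 m := pell_exprSS m ssq.
have p2 m : (3 + 2 * - s) ^+ m.+2 = 6 * (3 + 2 * - s) ^+ m.+1 - (3 + 2 * - s) ^+ m.
  by apply: pell_exprSS; rewrite sqrrN.
elim/two_step_ind: n => [||n h0 h1].
- by rewrite /= !expr0; field.
- rewrite (_ : size _ = 6%N) // !expr1.
  have -> : (4 + 3 * s) / 8 * (3 + 2 * s) + (4 - 3 * s) / 8 * (3 - 2 * s) =
    3 + 12 / 8 * s ^+ 2 by field.
  by rewrite ssq; field.
- have := congr1 (fun m => m%:R : F) (size_words_rec n).
  rewrite /= natrD natrM h0 h1 => /(canRL (addrK _)) ->.
  by rewrite !mE p1 p2; field.
Qed.

Lemma weight_wordsE (F : numFieldType) (s : F) n : s ^+ 2 = 2 -> 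
  (\sum_(w <- words n) weight w)%N%:R =
  3 * s / 64 * (3 - 2 * s) ^+ n + (17 - 12 * s) / 16 * n%:R * (3 - 2 * s) ^+ n
  - 3 * s / 64 * (3 + 2 * s) ^+ n + (17 + 12 * s) / 16 * n%:R * (3 + 2 * s) ^+ n :> F.
Proof.
move=> ssq; have mE : 3 - 2 * s = 3 + 2 * - s by ring.
have p1 m := pell_exprSS m ssq.
have p2 m : (3 + 2 * - s) ^+ m.+2 = 6 * (3 + 2 * - s) ^+ m.+1 - (3 + 2 * - s) ^+ m.
  by apply: pell_exprSS; rewrite sqrrN.
elim/two_step_ind: n => [||n h0 h1].
- by rewrite big_seq1 /weight /= !expr0; field.
- have -> : (\sum_(w <- words 1) weight w = 12)%N by rewrite unlock.
  rewrite !expr1.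
  have -> : 3 * s / 64 * (3 - 2 * s) + (17 - 12 * s) / 16 * 1%:R * (3 - 2 * s)
    - 3 * s / 64 * (3 + 2 * s) + (17 + 12 * s) / 16 * 1%:R * (3 + 2 * s) =
    102 / 16 + (3 - 3 / 16) * s ^+ 2 by field.
  by rewrite ssq; field.
- have : (\sum_(w <- words n.+2) weight w)%N%:R +
      ((\sum_(w <- words n) weight w)%N%:R + 2 * (size (words n))%:R) =
      6 * (\sum_(w <- words n.+1) weight w)%N%:R + 12 * (size (words n.+1))%:R :> F.
    by rewrite -!natrM -!natrD addnA weight_words_rec.
  rewrite h0 h1 !(size_wordsE _ ssq) => /(canRL (addrK _)) ->.
  rewrite !mE p1 p2.
  by rewrite !exprS -[n.+2]addn2 -[n.+1]addn1 !natrD; field.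
Qed.

Theorem theorem4p4 (R : rcfType) (n : nat) :
  ((\sum_(M : {set {set pyr_vertex n}} | perfect_matching (pyrene_V n) (pyrene_E n) M)
      anti_forcing_number (pyrene_V n) (pyrene_E n) M)%N%:R : R)
  = 3 * Num.sqrt 2 / 64 * (3 - 2 * Num.sqrt 2) ^+ n
    + (17 - 12 * Num.sqrt 2) / 16 * n%:R * (3 - 2 * Num.sqrt 2) ^+ n
    - 3 * Num.sqrt 2 / 64 * (3 + 2 * Num.sqrt 2) ^+ n
    + (17 + 12 * Num.sqrt 2) / 16 * n%:R * (3 + 2 * Num.sqrt 2) ^+ n.
Proof. by rewrite sum_anti_forcing; apply: weight_wordsE; rewrite sqr_sqrtr. Qed.
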